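(* Define a sequence $a_{nrt}$, for $n\in\mathbb N$ and $(r,t)\in J(n)$, by \begin{align*} a_{nn0}&=1 &&\text{for all }n,\\ a_{n0t}&=a_n &&\text{if $n-t$ is even},\\ a_{nrt}&=a_{n-1,r-1,t}+(n-r-t)\,a_{n-2,r,t} &&\text{if $n\ge 2$ and }1\le r\le n-1, \end{align*} where the sequence $a_n$ is defined by $a_0=a_1=1$ and $a_n=a_{n-1}+(n-1)a_{n-2}$ for $n\ge2$. For $n\in\mathbb N$ and $(r,t)\in J(n)$ with $n-r-t=2k$, put $\rho_{nrt}=\binom nr\binom{n-r}t(2k-1)!!=\frac{n!}{2^k\,k!\,r!\,t!}$. Then for any $n\in\mathbb N$ and $(r,t)\in J(n)$: (i) $e(R_\alpha(\mathcal{PB}_n))=a_{nrt}$ for any $\alpha\in D_r(\mathcal{PB}_n)$ with $t$ singleton non-transversal upper-kernel classes; (ii) $e(D_r(\mathcal{PB}_n))=\sum_{t\in I(n-r)}\rho_{nrt}\,a_{nrt}$; (iii) $e(\mathcal{PB}_n)=\sum_{(r,t)\in J(n)}\rho_{nrt}\,a_{nrt}$.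
   Context: $\mathbb N=\{0,1,2,\dots\}$, $I(n)=\{r\in\{0,\dots,n\}:n-r\text{ is even}\}$, and $J(n)=\{(r,t)\in\{0,\dots,n\}^2: t\in I(n-r)\}$, i.e. pairs with $r+t\le n$ and $n-r-t$ even. For odd $k$, $k!!=k(k-2)\cdots3\cdot1$, with $(-1)!!=1$. In the recurrence, when $n-r-t=0$ the term $(n-r-t)a_{n-2,r,t}$ is $0$ (even though $(r,t)\notin J(n-2)$). Write $\mathbf n=\{1,\dots,n\}$ and let $\mathbf n'$ be a disjoint copy. The partial Brauer monoid $\mathcal{PB}_n$ is the set of all set partitions $\alpha$ of $\mathbf n\cup\mathbf n'$ into non-empty blocks of size at most $2$. Product: for $\alpha,\beta\in\mathcal{PB}_n$ take a third copy $\mathbf n''$; relabel each lower vertex $x'$ of $\alpha$ as $x''$ and each upper vertex $x$ of $\beta$ as $x''$, and take the union graph $\Gamma(\alpha,\beta)$ on $\mathbf n\cup\mathbf n'\cup\mathbf n''$ (blocks of size $2$ being viewed as edges); $x,y\in\mathbf n\cup\mathbf n'$ are in the same block of $\alpha\beta$ iff they are joined by a path in $\Gamma(\alpha,\beta)$. The rank of $\alpha$ is the number of blocks meeting both $\mathbf n$ and $\mathbf n'$, and $D_r(\mathcal{PB}_n)=\{\alpha\in\mathcal{PB}_n:\operatorname{rank}(\alpha)=r\}$. For $\alpha\in\mathcal{PB}_n$, $\Lambda^\wedge(\alpha)$ is the graph on $\mathbf n$ with an edge $\{i,j\}$ for each block $\{i,j\}\subseteq\mathbf n$ (with $i\ne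 j$) of $\alpha$ and a loop at $i$ whenever $\{i\}$ is a block of $\alpha$. $R_\alpha(\mathcal{PB}_n)=\{\beta\in\mathcal{PB}_n:\Lambda^\wedge(\beta)=\Lambda^\wedge(\alpha)\}$; this is the $\mathscr R$-class of $\alpha$ in $\mathcal{PB}_n$ (Green's relation). The number of singleton non-transversal upper-kernel classes of $\alpha$ is the number of $i\in\mathbf n$ such that $\{i\}$ is a block of $\alpha$. For $\Sigma\subseteq\mathcal{PB}_n$, $e(\Sigma)$ is the number of $\alpha\in\Sigma$ with $\alpha^2=\alpha$. *)

(* Defs.v *)
From HB Require Import structures.
From mathcomp Require Import all_boot all_order all_algebra.

Set Implicit Arguments.
Unset Strict Implicit.
Unset Printing Implicit Defensive.

Local Open Scope nat_scope.

(** * The partial Brauer monoid *)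

(* [inl i] is the upper vertex i, [inr i] is the lower vertex i'; vertices are
   numbered from 0 to n-1 in each row. *)
Definition vertex (n : nat) : finType := ('I_n + 'I_n)%type.

Definition is_PB (n : nat) (P : {set {set vertex n}}) : bool :=
  partition P [set: vertex n] && [forall B in P, #|B| <= 2].

Record PB (n : nat) := MkPB {
  blocks :> {set {set vertex n}};
  blocksP : is_PB blocks
}.

HB.instance Definition _ n := [isSub for @blocks n].
HB.instance Definition _ n := [Finite of PB n by <:].

(* The vertices of the product graph: [inl v] is a vertex v of the upper or
   lower row, [inr i] is the vertex i'' of the middle row. *)
Definition gvertex (n : nat) : finType := (vertex n + 'I_n)%type.

Definition top_emb n (v : vertex n) : gvertex n :=
  match v with inl i => inl (inl i) | inr i => inr i end.
Definition bot_emb n (v : vertex n) : gvertex n :=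
  match v with inl i => inr i | inr i => inl (inr i) end.

Definition edge_via n (f : vertex n -> gvertex n) (a : PB n) : rel (gvertex n) :=
  fun u v => [exists B in blocks a, (#|B| == 2) && (f @: B == [set u; v])].

Definition Gamma n (a b : PB n) : rel (gvertex n) :=
  fun u v => edge_via (@top_emb n) a u v || edge_via (@bot_emb n) b u v.

Definition joined n (a b : PB n) : rel (vertex n) :=
  fun x y => connect (Gamma a b) (inl x) (inl y).

Definition mul_blocks n (a b : PB n) : {set {set vertex n}} :=
  equivalence_partition (joined a b) [set: vertex n].

(* [PB n] is closed under products: in the product graph outer vertices have
   degree at most 1 and middle vertices have degree at most 2, so each
   component contains at most two outer vertices. *)
Lemma top_emb_inj n : injective (@top_emb n).
Proof. by move=> [i|i] [j|j] //= [->]. Qed.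

Lemma bot_emb_inj n : injective (@bot_emb n).
Proof. by move=> [i|i] [j|j] //= [->]. Qed.

Lemma edge_viaC n f (a : PB n) : symmetric (edge_via f a).
Proof. by move=> u v; apply: eq_existsb => B; rewrite setUC. Qed.

Lemma Gamma_sym n (a b : PB n) : symmetric (Gamma a b).
Proof. by move=> u v; rewrite /Gamma !(edge_viaC _ _ u). Qed.

Lemma edge_via_codom n f (a : PB n) u v :
  edge_via f a u v -> exists x, f x = u.
Proof.
move=> /existsP[B /and3P[_ _ /eqP E]].
have : u \in f @: B by rewrite E !inE eqxx.
by case/imsetP => x _ ->; exists x.
Qed.

Lemma edge_via_uniq n f (a : PB n) u v w : injective f ->
  edge_via f a u v -> edge_via f a u w -> v = w.
Proof.
move=> fI /existsP[B /and3P[Ba /eqP cB /eqP E]].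
move=> /existsP[C /and3P[Ca /eqP cC /eqP F]].
have eBC : B = C.
  have /imsetP[x xB ux] : u \in f @: B by rewrite E !inE eqxx.
  have /imsetP[y yC uy] : u \in f @: C by rewrite F !inE eqxx.
  have exy : x = y by apply: fI; rewrite -ux -uy.
  have /andP[/and3P[_ tI _] _] := blocksP a.
  by rewrite -(def_pblock tI Ba xB) -(def_pblock tI Ca yC) exy.
have c2 : #|[set u; v]| = 2 by rewrite -E card_imset.
have : v \in [set u; w] by rewrite -F -eBC E !inE eqxx orbT.
rewrite !inE => /orP[/eqP uv|/eqP //].
by move: c2; rewrite uv setUid cards1.
Qed.

Lemma Gamma_outer_uniq n (a b : PB n) x v w :
  Gamma a b (inl x) v -> Gamma a b (inl x) w -> v = w.
Proof.
rewrite /Gamma => /orP[] Hv /orP[] Hw.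
- exact: edge_via_uniq (@top_emb_inj n) Hv Hw.
- have [[?|?] //= []] := edge_via_codom Hv.
  by have [[?|?] //= [<-]] := edge_via_codom Hw.
- have [[?|?] //= []] := edge_via_codom Hv.
  by have [[?|?] //= [<-]] := edge_via_codom Hw.
- exact: edge_via_uniq (@bot_emb_inj n) Hv Hw.
Qed.

Lemma Gamma_next_uniq n (a b : PB n) u p v w :
  Gamma a b u p -> Gamma a b u v -> Gamma a b u w ->
  v != p -> w != p -> v = w.
Proof.
have T := edge_via_uniq (@top_emb_inj n).
have L := edge_via_uniq (@bot_emb_inj n).
move=> /orP[] Hp /orP[] Hv /orP[] Hw /eqP Nv /eqP Nw.
- exact: T Hv Hw.
- by case: Nv; apply: T Hv Hp.
- by case: Nw; apply: T Hw Hp.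
- exact: L Hv Hw.
- exact: T Hv Hw.
- by case: Nw; apply: L Hw Hp.
- by case: Nv; apply: L Hv Hp.
- exact: L Hv Hw.
Qed.

Lemma Gamma_path_last n (a b : PB n) p q c u y z :
  Gamma a b u c -> path (Gamma a b) u p -> path (Gamma a b) u q ->
  c \notin p -> c \notin q -> uniq (u :: p) -> uniq (u :: q) ->
  last u p = inl y -> last u q = inl z -> y = z.
Proof.
elim: p q c u => [|v p IHp] [|w q] c u /= uc.
- by move=> _ _ _ _ _ _ -> [].
- move=> _ /andP[uw _] _ cq _ _ E _; move: uc uw; rewrite E => uc uw.
  by rewrite (Gamma_outer_uniq uc uw) inE eqxx in cq.
- move=> /andP[uv _] _ cp _ _ _ _ E; move: uc uv; rewrite E => uc uv.
  by rewrite (Gamma_outer_uniq uc uv) inE eqxx in cp.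
rewrite !inE !negb_or.
move=> /andP[uv pp] /andP[uw pq] /andP[cv cp] /andP[cw cq].
move=> /andP[/andP[_ up] Up] /andP[/andP[_ uq] Uq].
have evw : v = w by apply: Gamma_next_uniq uc uv uw _ _; rewrite eq_sym.
subst w; apply: (IHp q u v) => //; by rewrite Gamma_sym.
Qed.

Lemma joined_uniq n (a b : PB n) x y z :
  joined a b x y -> joined a b x z -> x != y -> x != z -> y = z.
Proof.
move=> /connectP[p0 /shortenP[p pp Up _] Ey].
move=> /connectP[q0 /shortenP[q pq Uq _] Ez].
case: p pp Up Ey => [_ _ [->]|u p /= /andP[xu pp] /andP[xp Up] Ey].
  by rewrite eqxx.
case: q pq Uq Ez => [_ _ [->]|v q /= /andP[xv pq] /andP[xq Uq] Ez].
  by rewrite eqxx.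
have euv := Gamma_outer_uniq xu xv; subst v => _ _.
move: xp xq; rewrite !inE !negb_or => /andP[_ xp] /andP[_ xq].
by apply: (@Gamma_path_last _ a b p q (inl x) u) => //; rewrite Gamma_sym.
Qed.

Lemma joined_equiv n (a b : PB n) :
  {in [set: vertex n] & &, equivalence_rel (joined a b)}.
Proof.
move=> x y z _ _ _; split; first exact: connect0.
by move=> xy; apply: (same_connect (sym_connect_sym (@Gamma_sym n a b))).
Qed.

Lemma mul_blocksP n (a b : PB n) : is_PB (mul_blocks a b).
Proof.
rewrite /is_PB equivalence_partitionP ?andTb; last exact: joined_equiv.
apply/forall_inP => B /imsetP[x _ ->].
rewrite leqNgt; apply/negP => c3.
set A := [set _ in _ | _] in c3.
have xA : x \in A by rewrite !inE; exact: connect0.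
rewrite (cardsD1 x) xA ltnS in c3.
have /card_gt1P[y [z [yA zA /eqP]]] := c3; apply.
move: yA zA; rewrite !inE => /andP[yx xy] /andP[zx xz].
by apply: joined_uniq xy xz _ _; rewrite eq_sym.
Qed.

Definition mul n (a b : PB n) : PB n := MkPB (mul_blocksP a b).

Definition rank n (a : PB n) : nat :=
  #|[set B in blocks a |
      [exists i, inl i \in B] && [exists j, inr j \in B]]|.

Definition D_class (n r : nat) : {set PB n} := [set a : PB n | rank a == r].

(* A graph on the upper row, possibly with loops, is given by its set of
   ordered adjacent pairs. *)
Definition Lambda_up n (a : PB n) : {set 'I_n * 'I_n} :=
  [set p | if p.1 == p.2 then [set inl p.1] \in blocks a
           else [set inl p.1; inl p.2] \in blocks a].

Definition R_class n (a : PB n) : {set PB n} :=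
  [set b : PB n | Lambda_up b == Lambda_up a].

Definition upper_singletons n (a : PB n) : nat :=
  #|[set i : 'I_n | [set inl i] \in blocks a]|.

Definition e n (S : {set PB n}) : nat := #|[set a in S | mul a a == a]|.

(** * The numerical sequences *)

Definition inI (n r : nat) : bool := (r <= n) && ~~ odd (n - r).

Definition inJ (n r t : nat) : bool :=
  [&& r <= n, t <= n & inI (n - r) t].

Fixpoint a_seq (n : nat) : nat :=
  match n with
  | 0 => 1
  | m.+1 => match m with
            | 0 => 1
            | l.+1 => a_seq m + m * a_seq l
            end
  end.

(* Only the values at [inJ n r t] are meaningful; the recurrence is given by
   [a_nn0], [a_n0t] and [a_rec] below. *)
Fixpoint a_nrt (n r t : nat) : nat :=
  match r with
  | 0 => a_seq n
  | q.+1 => if r == n then 1 else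
            match n with
            | 0 => 0
            | m.+1 => match m with
                      | 0 => 0
                      | l.+1 => a_nrt m q t + (n - r - t) * a_nrt l r t
                      end
            end
  end.

Lemma a_nn0 n : a_nrt n n 0 = 1.
Proof. by case: n => //= n; rewrite eqxx. Qed.

Lemma a_n0t n t : a_nrt n 0 t = a_seq n.
Proof. by case: n. Qed.

Lemma a_rec n r t : 2 <= n -> 1 <= r <= n.-1 ->
  a_nrt n r t = a_nrt n.-1 r.-1 t + (n - r - t) * a_nrt (n - 2) r t.
Proof.
case: n => [|[|n]] // _; case: r => [|r] //= lt_rn.
by rewrite ltn_eqF ?subn2.
Qed.

Fixpoint dfact (k : nat) : nat :=
  match k with
  | l.+2 => k * dfact l
  | _ => 1
  end.

(* For n - r - t = 2k the last factor is (2k-1)!!; for k = 0 the predecessor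
   is truncated to 0, and 0!! = 1 agrees with the convention (-1)!! = 1. *)
Definition rho (n r t : nat) : nat :=
  'C(n, r) * 'C(n - r, t) * dfact (n - r - t).-1.

(* Main.v *)
Require Import Defs.
From HB Require Import structures.
From mathcomp Require Import all_boot all_order all_algebra.
From mathcomp Require Import zify ring.

Set Implicit Arguments.
Unset Strict Implicit.
Unset Printing Implicit Defensive.

Local Open Scope nat_scope.

(** An element of the monoid consists of an upper pattern [u], a lower pattern
    [l], and a bijection from the upper points left free by [u] to the lower
    points left free by [l]; a pattern is a partial matching of the row in which
    a point may also be matched with itself (a singleton block).  In the product
    of the element with itself, the middle row carries the union of the graphs
    of [u] and [l], whose components are paths and cycles.  The element is
    idempotent exactly when each transversal [{i, j'}] has its ends [i] and [j]
    in one component of that graph ([idempotentP]).  A component contains at most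
    one free point of [l] joined to a given free point of [u]
    ([free_end_uniq]), so an idempotent is determined by [(u, l)], and it exists
    exactly when the components pair off the free points of [u] with those of
    [l] ([balanced]).  Thus the idempotents of an R-class, for which [u] is
    fixed, are counted by the matchings [l] that are balanced against [u].

    These are counted by choosing a free point [x] of [u] ([card_balanced]).  If
    [x] is free in [l] as well, delete it: [r] and [n] drop by one.  Otherwise
    [l] joins [x] to some [y].  If [y] is free in [u], is a singleton of [u], or
    is [x] itself, the walk that starts at [x] never reaches a free point of
    [l].  So [u] joins [y] to some [z] other than [y], which leaves [n - r - t]
    choices of [y]; contracting the path [x - y - z] to the point [z], now free
    in [u], removes two points and keeps [r] and [t].  This is the recurrence of
    [a_nrt].  If [u] has no free point then the only requirement is that [l] has
    none either, and such [l] are the involutions, counted by [a_seq].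

    The sum over a rank class groups the elements by their upper pattern: there
    are [rho n r t] patterns with [r] free points and [t] singletons
    ([card_matchings_rank]), chosen as the free set, then the singletons, then a
    fixed-point-free involution of the rest. *)

(** * Partial matchings of a finite set *)

Section Matchings.

Variable T : finType.

(** The value [None] marks a free point and [l x = Some x] a singleton.  Points
    outside [S] are required to be free, so that deleting points from the
    support does not change the carrier type. *)
Definition matchings (S : {set T}) : {set {ffun T -> option T}} :=
  [set l : {ffun T -> option T} |
    [forall x, forall y, (l x == Some y) ==> (x \in S) && (l y == Some x)]].

Implicit Types (S : {set T}) (u l : {ffun T -> option T}) (x y : T).

Lemma matchingsP S l :
  reflect (forall x y, l x = Some y -> x \in S /\ l y = Some x)
          (l \in matchings S).
Proof.
rewrite inE; apply: (iffP forallP) => [h x y lxy|h x].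
  by move/forallP/(_ y): (h x); rewrite lxy eqxx => /andP[-> /eqP].
by apply/forallP=> y; apply/implyP=> /eqP/h[-> ->]; rewrite eqxx.
Qed.

Lemma matching_sym S l x y : l \in matchings S -> l x = Some y -> l y = Some x.
Proof. by move/matchingsP=> h /h[]. Qed.

Lemma matching_in S l x y : l \in matchings S -> l x = Some y -> x \in S.
Proof. by move/matchingsP=> h /h[]. Qed.

Lemma matching_inr S l x y : l \in matchings S -> l x = Some y -> y \in S.
Proof. by move=> lS /(matching_sym lS)/(matching_in lS). Qed.

Lemma matching_out S l x : l \in matchings S -> x \notin S -> l x = None.
Proof.
by move=> lS; case E: (l x) => [y|] //; rewrite (matching_in lS E).
Qed.

Lemma matchingsS S S' l : S \subset S' -> l \in matchings S -> l \in matchings S'.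
Proof.
move=> sSS' lS; apply/matchingsP => x y lxy.
by rewrite (subsetP sSS') ?(matching_in lS lxy) ?(matching_sym lS lxy).
Qed.

Definition cut l x : {ffun T -> option T} :=
  [ffun i => if (i == x) || (Some i == l x) then None else l i].

Lemma cut_matching S l x y : l \in matchings S -> l x = Some y ->
  cut l x \in matchings (S :\ x :\ y).
Proof.
move=> lS lxy; apply/matchingsP => i j.
rewrite !ffunE lxy !inE; case: ifP => // /negbT; rewrite negb_or => /andP[ix iy] lij.
have lji := matching_sym lS lij.
rewrite (matching_in lS lij) ix !andbT; split; first exact: iy.
case: eqP => [jx|_] /=; first by move: iy; rewrite -lji jx lxy eqxx.
case: eqP => [[jy]|_] //.
by move: ix; have := matching_sym lS lxy; rewrite -jy lji => -[->] /negP; rewrite eqxx.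
Qed.

Lemma cut_matchingW S l x : l \in matchings S -> cut l x \in matchings S.
Proof.
move=> lS; apply/matchingsP => i j.
rewrite !ffunE; case: ifP => // /negbT; rewrite negb_or => /andP[ix iy] lij.
have lji := matching_sym lS lij; split; first exact: matching_in lij.
case: eqP => [jx|_] /=; first by move: iy; rewrite -lji jx eqxx.
case: eqP => [jy|_] //.
by move: ix; have := matching_sym lS (esym jy); rewrite lji => -[->]; rewrite eqxx.
Qed.

(** Deleting [x] and its partner [y] is a bijection onto the matchings of the
    remaining points.  The case [y = x] is allowed: it deletes a singleton. *)
Lemma card_matchings_at S x y (P Q : pred {ffun T -> option T}) :
    x \in S -> y \in S ->
    (forall l, l \in matchings S -> l x = Some y -> P l = Q (cut l x)) ->
  #|[set l in matchings S | (l x == Some y) && P l]| =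
  #|[set l in matchings (S :\ x :\ y) | Q l]|.
Proof.
move=> xS yS PQ.
rewrite -(@card_in_imset _ _ (fun l => cut l x)); last first.
  move=> l m; rewrite inE => /and3P[lS' /eqP lx _].
  rewrite inE => /and3P[mS' /eqP mx _].
  move=> /ffunP E; apply/ffunP=> i; have := E i; rewrite !ffunE lx mx.
  case: eqP => [->|_] /=; first by rewrite lx mx.
  case: eqP => [[->]|_] // _.
  by rewrite (matching_sym lS' lx) (matching_sym mS' mx).
apply: eq_card => m; apply/imsetP/idP => [[l]|].
  rewrite inE => /and3P[lS /eqP lx Pl] ->.
  by rewrite inE cut_matching //= -PQ.
rewrite inE => /andP[mS Qm].
have mx : m x = None by apply: (matching_out mS); rewrite !inE eqxx andbF.
have my : m y = None by apply: (matching_out mS); rewrite !inE eqxx.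
pose l := [ffun i => if i == x then Some y else if i == y then Some x else m i].
have lx : l x = Some y by rewrite ffunE eqxx.
have lS : l \in matchings S.
  apply/matchingsP => i j; rewrite !ffunE.
  case: (eqVneq i x) => [->|ix].
    by move=> [<-]; rewrite xS eqxx; split=> //; case: eqP => // ->.
  case: (eqVneq i y) => [->|iy]; first by move=> [<-]; rewrite eqxx yS.
  move=> mij; have := matching_in mS mij; rewrite !inE => /and3P[_ _ ->].
  have := matching_inr mS mij; rewrite !inE => /and3P[/negbTE-> /negbTE-> _].
  by rewrite (matching_sym mS mij).
have ml : m = cut l x.
  apply/ffunP=> i; rewrite [RHS]ffunE lx [l i]ffunE.
  case: eqP => [->//|_] /=.
  have -> : (Some i == Some y) = (i == y) by [].
  by case: eqP => [->|].
by exists l; rewrite // inE lS lx eqxx PQ // -ml.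
Qed.

(** Sorting matchings by the partner of a chosen point; one in which [x] is free
    is the same function as a matching supported on the other points. *)
Lemma card_matchings_split S x (P : pred {ffun T -> option T}) : x \in S ->
  #|[set l in matchings S | P l]| =
  #|[set l in matchings (S :\ x) | P l]| +
  \sum_(y in S) #|[set l in matchings S | (l x == Some y) && P l]|.
Proof.
move=> xS.
rewrite -!sum1dep_card (bigID (fun l => l x == None)) /=; congr (_ + _).
  apply: eq_bigl => l; apply/idP/idP.
    move=> /andP[/andP[lS Pl] /eqP lx]; rewrite Pl andbT.
    apply/matchingsP => i j lij; rewrite !inE (matching_in lS lij).
    rewrite (matching_sym lS lij); case: eqP => // ix.
    by move: lij; rewrite ix lx.
  move=> /andP[lS Pl]; rewrite Pl andbT (matching_out lS) ?eqxx ?andbT;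
    last by rewrite !inE eqxx.
  apply/matchingsP => i j lij; have := matching_in lS lij.
  by rewrite !inE (matching_sym lS lij) => /andP[_ ->].
rewrite (partition_big (fun l => odflt x (l x)) (mem S)) /=; last first.
  move=> l /andP[/andP[lS _]]; case E: (l x) => [y|] //= _.
  exact: matching_inr lS E.
apply: eq_bigr => y yS; rewrite -sum1dep_card; apply: eq_bigl => l.
case: (l \in _) => //; case: (P l) => /=; last by rewrite andbF.
case: (l x) => [z|] /=; rewrite ?andbT ?andbF //.
Qed.

Definition full S l := [forall i in S, l i != None].

Lemma fullP S l : reflect (forall i, i \in S -> l i <> None) (full S l).
Proof.
apply: (iffP forall_inP) => h i iS; first by apply/eqP/h.
by apply/eqP/h.
Qed.

Lemma full_cut S l x y : l \in matchings S -> l x = Some y ->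
  full S l = full (S :\ x :\ y) (cut l x).
Proof.
move=> lS lxy; have lyx := matching_sym lS lxy; apply/fullP/fullP => h i.
  rewrite !inE => /and3P[iy ix iS]; rewrite ffunE lxy (negbTE ix) /=.
  have -> : (Some i == Some y) = (i == y) by [].
  by rewrite (negbTE iy); apply: h.
move=> iS; case: (eqVneq i x) => [->|ix]; first by rewrite lxy.
case: (eqVneq i y) => [->|iy]; first by rewrite lyx.
have := h i; rewrite !inE ix iy iS ffunE lxy (negbTE ix) /=.
have -> : (Some i == Some y) = (i == y) by [].
by rewrite (negbTE iy); apply.
Qed.

Lemma card_setD2 S x y : x \in S -> y \in S -> x != y ->
  #|S :\ x :\ y| = #|S| - 2.
Proof.
move=> xS yS xy; rewrite (cardsD1 x S) xS (cardsD1 y (S :\ x)) !inE eq_sym xy yS.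
by rewrite !add1n subn2.
Qed.

(** Full matchings are the involutions of [S]: the chosen point [x] is either
    fixed or exchanged with one of the others. *)
Lemma card_full S : #|[set l in matchings S | full S l]| = a_seq #|S|.
Proof.
move: {2}#|S|.+1 (ltnSn #|S|) => m; elim: m S => // m IHm S le_Sm.
case: (set_0Vmem S) => [S0|[x xS]].
  rewrite S0 cards0 /= (_ : [set l in _ | _] = [set [ffun=> None]]) ?cards1 //.
  apply/setP=> l; rewrite inE [RHS]inE; apply/andP/eqP => [[lS _]|->].
    by apply/ffunP => i; rewrite ffunE (matching_out lS) ?inE.
  split; first by apply/matchingsP => i j; rewrite ffunE.
  by apply/fullP=> i; rewrite inE.
rewrite (card_matchings_split _ xS) [X in X + _]eq_card0 ?add0n; last first.
  move=> l; rewrite inE; apply/negP => /andP[lS /fullP/(_ x xS)]; apply.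
  by rewrite (matching_out lS) // !inE eqxx.
have eqS := cardsD1 x S; rewrite xS add1n in eqS.
have at_ y : y \in S ->
    #|[set l in matchings S | (l x == Some y) && full S l]| =
    a_seq #|S :\ x :\ y|.
  move=> yS; rewrite (card_matchings_at (Q := full (S :\ x :\ y)) xS yS).
    apply: IHm; apply: leq_trans (_ : #|S| <= m) => //; rewrite eqS ltnS.
    by rewrite subset_leq_card // subsetDl.
  by move=> l lS lxy; apply: full_cut.
rewrite (bigD1 x xS) /= at_ //.
have -> : S :\ x :\ x = S :\ x by apply/setP => i; rewrite !inE; case: eqP.
rewrite (eq_bigr (fun=> a_seq (#|S| - 2))) => [|y /andP[yS yx]]; last first.
  by rewrite at_ // card_setD2 // eq_sym.
rewrite sum_nat_const.
have -> : #|[pred i | (i \in S) & i != x]| = #|S :\ x|.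
  by apply: eq_card => i; rewrite !inE andbC.
rewrite eqS; case: #|S :\ x| => [|k] //=; by rewrite subSS subn1.
Qed.

Definition fixfree l := [forall i, l i != Some i].

Lemma fixfree_cut S l x y : l \in matchings S -> l x = Some y -> x != y ->
  fixfree l = fixfree (cut l x).
Proof.
move=> lS lxy xy; have lyx := matching_sym lS lxy.
apply/forallP/forallP => h i; have := h i; rewrite ffunE lxy.
  by case: ifP.
have -> : (Some i == Some y) = (i == y) by [].
case: (eqVneq i x) => [-> _|_] /=.
  by rewrite lxy; apply: contra xy => /eqP[->].
by case: (eqVneq i y) => [-> _|_] //; rewrite lyx.
Qed.

Lemma card_fixfree S :
  #|[set l in matchings S | full S l && fixfree l]| =
  if odd #|S| then 0 else dfact #|S|.-1.
Proof.
move: {2}#|S|.+1 (ltnSn #|S|) => m; elim: m S => // m IHm S le_Sm.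
case: (set_0Vmem S) => [S0|[x xS]].
  rewrite S0 cards0 /= (_ : [set l in _ | _] = [set [ffun=> None]]) ?cards1 //.
  apply/setP=> l; rewrite inE [RHS]inE; apply/andP/eqP => [[lS _]|->].
    by apply/ffunP => i; rewrite ffunE (matching_out lS) ?inE.
  split; first by apply/matchingsP => i j; rewrite ffunE.
  by apply/andP; split; apply/forallP=> i; rewrite ?inE ?ffunE.
rewrite (card_matchings_split _ xS) [X in X + _]eq_card0 ?add0n; last first.
  move=> l; rewrite inE; apply/negP => /andP[lS /andP[/fullP/(_ x xS) + _]].
  by apply; rewrite (matching_out lS) // !inE eqxx.
have eqS := cardsD1 x S; rewrite xS add1n in eqS.
rewrite (bigD1 x xS) /= [X in X + _]eq_card0 ?add0n; last first.
  move=> l; rewrite inE; apply/negP => /and4P[_ /eqP lx _ /forallP/(_ x)].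
  by rewrite lx eqxx.
have at_ y : y \in S -> x != y ->
    #|[set l in matchings S | (l x == Some y) && (full S l && fixfree l)]| =
    if odd (#|S| - 2) then 0 else dfact (#|S| - 2).-1.
  move=> yS xy; rewrite -(card_setD2 xS yS xy).
  rewrite (card_matchings_at xS yS
    (Q := fun l => full (S :\ x :\ y) l && fixfree l)).
    apply: IHm; apply: leq_trans (_ : #|S| <= m) => //; rewrite eqS ltnS.
    by rewrite subset_leq_card // subsetDl.
  by move=> l lS lxy; rewrite (full_cut lS lxy) (fixfree_cut lS lxy).
rewrite (eq_bigr (fun=> if odd (#|S| - 2) then 0 else dfact (#|S| - 2).-1));
  last by move=> y /andP[yS yx]; rewrite at_ // eq_sym.
rewrite sum_nat_const.
have -> : #|[pred i | (i \in S) & i != x]| = #|S :\ x|.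
  by apply: eq_card => i; rewrite !inE andbC.
rewrite eqS; case: #|S :\ x| => [|[|k]] //=.
by rewrite negbK; case: odd; rewrite ?muln0.
Qed.

(** * Overlaying two matchings *)

Definition overlay u l : rel T :=
  fun i j => (u i == Some j) || (l i == Some j).

(** On the points outside the common support of [u] and [l] the condition holds
    trivially, since such a point is free in both and joined to itself.  Hence
    no support appears in the definition, and deleting a point that is free in
    both matchings preserves balance. *)
Definition balanced u l :=
  [forall i, (u i == None) ==>
     [exists j, (l j == None) && connect (overlay u l) i j]] &&
  [forall j, (l j == None) ==>
     [exists i, (u i == None) && connect (overlay u l) i j]].

Lemma balancedP u l :
  reflect ((forall i, u i = None ->
              exists2 j, l j = None & connect (overlay u l) i j) /\
           (forall j, l j = None ->
              exists2 i, u i = None & connect (overlay u l) i j))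
          (balanced u l).
Proof.
apply: (iffP andP) => -[h1 h2]; split.
- move=> i /eqP ui; move/forall_inP/(_ i ui)/exists_inP: h1 => [j /eqP]; by exists j.
- move=> i /eqP ui; move/forall_inP/(_ i ui)/exists_inP: h2 => [j /eqP]; by exists j.
- apply/forall_inP=> i /eqP/h1[j lj ij]; apply/exists_inP; exists j => //; exact/eqP.
- apply/forall_inP=> i /eqP/h2[j lj ij]; apply/exists_inP; exists j => //; exact/eqP.
Qed.

Lemma overlay_sym S S' u l : u \in matchings S -> l \in matchings S' ->
  symmetric (overlay u l).
Proof.
move=> uS lS i j.
by apply/orP/orP => -[/eqP E|/eqP E]; [left|right|left|right];
   rewrite ?(matching_sym uS E) ?(matching_sym lS E).
Qed.

Lemma overlayC u l : overlay u l =2 overlay l u.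
Proof. by move=> i j; rewrite /overlay orbC. Qed.

(** Unlike in [closed_connect], [P] need only be preserved along the edges in
    their own direction. *)
Lemma connect_inv (e : rel T) (P : pred T) i j :
  (forall a b, P a -> e a b -> P b) -> connect e i j -> P i -> P j.
Proof.
move=> h /connectP[p + ->]; elim: p i => //= k p IHp i /andP[ik kp] Pi.
exact: IHp kp (h _ _ Pi ik).
Qed.

Lemma isolated u l i j : u i = None -> l i = None ->
  connect (overlay u l) i j -> j = i.
Proof.
move=> ui li /(connect_inv (P := pred1 i)) h; apply/eqP/h => //=.
by move=> a b /= /eqP->; rewrite /overlay ui li.
Qed.

(** The walk from the free point [x] goes to [y] along [l] and cannot leave
    [{x, y}], as [y] is free or a singleton in [u]; neither point is free in
    [l]. *)
Lemma stuck S u l x y j : l \in matchings S -> u x = None -> l x = Some y ->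
  (forall z, u y = Some z -> z = y) -> connect (overlay u l) x j ->
  l j <> None.
Proof.
move=> lS ux lxy uy xj; have lyx := matching_sym lS lxy.
suff: (j == x) || (j == y) by case/orP => /eqP->; rewrite ?lxy ?lyx.
apply: (connect_inv (P := fun j => (j == x) || (j == y))) xj _; last by rewrite eqxx.
move=> a b /orP[]/eqP-> /orP[]/eqP.
- by rewrite ux.
- by rewrite lxy => -[->]; rewrite eqxx orbT.
- by move/uy->; rewrite eqxx orbT.
- by rewrite lyx => -[->]; rewrite eqxx.
Qed.

(** Contraction of the path [x - y - z] to [z].  In [cut u y] and [cut l x] the
    points [x] and [y] are isolated, and [z] takes over the role of [x] as a free
    point of the first matching. *)
Section Contract.

Variables (S S' : {set T}) (u l : {ffun T -> option T}) (x y z : T).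
Hypotheses (uS : u \in matchings S) (lS : l \in matchings S').
Hypotheses (ux : u x = None) (lxy : l x = Some y) (uyz : u y = Some z).
Hypothesis (yz : z <> y).

Let u' := cut u y.
Let l' := cut l x.

Let lyx : l y = Some x. Proof. exact: matching_sym lS lxy. Qed.
Let uzy : u z = Some y. Proof. exact: matching_sym uS uyz. Qed.
Let nxy : x != y. Proof. by apply/eqP => xy; move: ux; rewrite xy uyz. Qed.
Let nzx : z != x. Proof. by apply/eqP => zx; move: ux; rewrite -zx uzy. Qed.

Let u'E i : u' i = if (i == y) || (i == z) then None else u i.
Proof. by rewrite /u' ffunE uyz. Qed.

Let l'E i : l' i = if (i == x) || (i == y) then None else l i.
Proof. by rewrite /l' ffunE lxy. Qed.

Lemma contract_sub i j :
  connect (overlay u' l') i j -> connect (overlay u l) i j.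
Proof.
apply: connect_sub => {}i {}j /orP[]; rewrite ?u'E ?l'E; case: ifP => // _ E;
  by apply: connect1; rewrite /overlay E ?orbT.
Qed.

(** Sending [x] and [y] to [z] turns each edge of the overlay into an edge of the
    contracted overlay or into a single point. *)
Lemma contract_map i j : i != x -> i != y -> j != x -> j != y ->
  connect (overlay u l) i j -> connect (overlay u' l') i j.
Proof.
move=> ix iy jx jy ij.
pose pi k := if (k == x) || (k == y) then z else k.
have : connect (overlay u' l') i (pi j).
  apply: (connect_inv (P := fun k => connect (overlay u' l') i (pi k))) ij _.
    move=> a b ia /orP[]/eqP E; apply: connect_trans ia _; rewrite /pi.
    + case: (eqVneq a x) => [ax|ax] /=; first by rewrite ax ux in E.
      case: (eqVneq a y) => [ay|ay] /=.
        move: E; rewrite ay uyz => -[<-].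
        by rewrite (negbTE nzx) (introF eqP yz).
      case: (eqVneq a z) => [az|az].
        by move: E; rewrite az uzy => -[<-]; rewrite eqxx orbT.
      case: (eqVneq b x) => [bx|bx] /=.
        by have := matching_sym uS E; rewrite bx ux.
      case: (eqVneq b y) => [eb|eb].
        by have := matching_sym uS E; rewrite eb uyz => -[za]; rewrite za eqxx in az.
      by apply: connect1; rewrite /overlay u'E (negbTE ay) (negbTE az) E eqxx.
    + case: (eqVneq a x) => [ax|ax] /=.
        by move: E; rewrite ax lxy => -[<-]; rewrite eqxx orbT.
      case: (eqVneq a y) => [ay|ay] /=.
        by move: E; rewrite ay lyx => -[<-]; rewrite eqxx.
      case: (eqVneq b x) => [bx|bx] /=.
        by have := matching_sym lS E; rewrite bx lxy => -[ya]; rewrite ya eqxx in ay.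
      case: (eqVneq b y) => [eb|eb].
        by have := matching_sym lS E; rewrite eb lyx => -[xa]; rewrite xa eqxx in ax.
      by apply: connect1; rewrite /overlay l'E (negbTE ay) (negbTE ax) E eqxx orbT.
  by rewrite /pi (negbTE ix) (negbTE iy).
by rewrite /pi (negbTE jx) (negbTE jy).
Qed.

Lemma contract_xz : connect (overlay u l) x z.
Proof.
apply: connect_trans (_ : connect _ x y) _; apply: connect1.
  by rewrite /overlay lxy eqxx orbT.
by rewrite /overlay uyz eqxx.
Qed.

Lemma contract_balanced : balanced u l = balanced u' l'.
Proof.
have u'y : u' y = None by rewrite u'E eqxx.
have l'x : l' x = None by rewrite l'E eqxx.
have l'y : l' y = None by rewrite l'E eqxx orbT.
have u'x : u' x = None by rewrite u'E ux; case: ifP.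
have u'z : u' z = None by rewrite u'E eqxx orbT.
have lN b : l b = None -> [/\ b != x, b != y & l' b = None].
  move=> lb; rewrite l'E lb if_same.
  by split=> //; apply/eqP => E; rewrite E ?lxy ?lyx in lb.
have l'N b : l' b = None -> b != x -> b != y -> l b = None.
  by move=> + bx b_y; rewrite l'E (negbTE bx) (negbTE b_y).
have u'N a : u' a = None -> a != y -> a != z -> u a = None.
  by move=> + ay az; rewrite u'E (negbTE ay) (negbTE az).
have nzy : z != y by apply/eqP.
apply/balancedP/balancedP => -[hu hl]; split.
- move=> a u'a; case: (eqVneq a x) => [->|ax]; first by exists x.
  case: (eqVneq a y) => [->|ay]; first by exists y.
  case: (eqVneq a z) => [->|az].
    have [b lb xb] := hu _ ux; have [bx b_y l'b] := lN _ lb; exists b => //.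
    apply: contract_map => //; apply: connect_trans _ xb.
    by rewrite (sym_connect_sym (overlay_sym uS lS)) contract_xz.
  have [b lb ab] := hu _ (u'N _ u'a ay az); have [bx b_y l'b] := lN _ lb.
  by exists b => //; apply: contract_map.
- move=> b l'b; case: (eqVneq b x) => [->|bx]; first by exists x.
  case: (eqVneq b y) => [->|b_y]; first by exists y.
  have [a ua ab] := hl _ (l'N _ l'b bx b_y).
  case: (eqVneq a x) => [ax|ax].
    exists z => //; apply: contract_map => //; rewrite ax in ab.
    apply: connect_trans _ ab.
    by rewrite (sym_connect_sym (overlay_sym uS lS)) contract_xz.
  have ay : a != y by apply/eqP => ay; rewrite ay uyz in ua.
  by exists a; [rewrite u'E ua; case: ifP | apply: contract_map].
- have key a a' : u' a = None -> a != x -> a != y ->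
      connect (overlay u l) a' a -> exists2 b, l b = None & connect (overlay u l) a' b.
    move=> u'a ax ay a'a; have [b l'b ab] := hu _ u'a; exists b.
      have sym := sym_connect_sym (overlay_sym (cut_matchingW y uS) (cut_matchingW x lS)).
      apply: l'N => //; apply/eqP => E; move: ab; rewrite E sym.
        by move/(isolated u'x l'x) => E'; rewrite E' eqxx in ax.
      by move/(isolated u'y l'y) => E'; rewrite E' eqxx in ay.
    by apply: connect_trans a'a _; apply: contract_sub.
  move=> a ua; case: (eqVneq a x) => [->|ax]; first exact: key contract_xz.
  apply: (key a) => //; first by rewrite u'E ua; case: ifP.
  by apply/eqP => ay; rewrite ay uyz in ua.
- move=> b lb; have [bx b_y l'b] := lN _ lb; have [a u'a ab] := hl _ l'b.
  have ax : a != x.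
    by apply/eqP=> E; move: ab bx; rewrite E => /(isolated u'x l'x)->; rewrite eqxx.
  have ay : a != y.
    by apply/eqP=> E; move: ab b_y; rewrite E => /(isolated u'y l'y)->; rewrite eqxx.
  have {}ab := contract_sub ab.
  case: (eqVneq a z) => [az|az]; last by exists a => //; apply: u'N.
  by exists x => //; apply: connect_trans contract_xz _; rewrite -az.
Qed.

End Contract.

(** A path has two ends.  Instead of following it explicitly, contract its first
    two edges as long as the end [x] is not itself free in [l]. *)
Lemma free_end_uniq S S' u l x b b' : u \in matchings S -> l \in matchings S' ->
  u x = None -> l b = None -> l b' = None ->
  connect (overlay u l) x b -> connect (overlay u l) x b' -> b = b'.
Proof.
move: {2}#|S'|.+1 (ltnSn #|S'|) => m.
elim: m S S' u l x => // m IHm S S' u l x le_m uS lS ux lb lb' xb xb'.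
case lx : (l x) => [y|]; last by rewrite (isolated ux lx xb) (isolated ux lx xb').
have notx c : l c = None -> c != x /\ c != y.
  by move=> lc; split; apply/eqP=> E; move: lc; rewrite E ?lx // (matching_sym lS lx).
case uy : (u y) => [z|]; last first.
  by case: (@stuck S' u l x y b lS ux lx) => // z; rewrite uy.
case: (eqVneq z y) => [zy|zy].
  by case: (@stuck S' u l x y b lS ux lx) => // z'; rewrite uy => -[<-].
have yz := elimN eqP zy.
have l'N c : l c = None -> cut l x c = None by move=> lc; rewrite ffunE lc; case: ifP.
have zx : z != x by apply/eqP => E; move: ux; rewrite -E (matching_sym uS uy).
have nxy : x != y by apply/eqP => E; move: ux; rewrite E uy.
have [bx b_y] := notx _ lb; have [bx' b_y'] := notx _ lb'.
have zP c : c != x -> c != y -> connect (overlay u l) x c ->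
    connect (overlay (cut u y) (cut l x)) z c.
  move=> cx cy xc; apply: (contract_map uS lS ux lx uy yz) => //.
  apply: connect_trans _ xc.
  by rewrite (sym_connect_sym (overlay_sym uS lS)); apply: contract_xz uy.
apply: (IHm _ _ _ _ z _ (cut_matchingW y uS) (cut_matching lS lx)) => //.
- rewrite ltnS in le_m; apply: leq_trans le_m; have xS := matching_in lS lx.
  by rewrite [X in _ < X](cardsD1 x) xS add1n ltnS subset_leq_card // subsetDl.
- by rewrite ffunE uy eqxx orbT.
- exact: l'N.
- exact: l'N.
- exact: zP.
- exact: zP.
Qed.

(** The recurrence of [a_nrt], by deletion or contraction at a free point [x] of
    [u]. *)
Lemma card_balanced S u : u \in matchings S ->
  #|[set l in matchings S | balanced u l]| =
  a_nrt #|S| #|[set i in S | u i == None]| #|[set i | u i == Some i]|.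
Proof.
move: {2}#|S|.+1 (ltnSn #|S|) => m; elim: m S u => // m IHm S u le_Sm uS.
set r := #|[set i in S | u i == None]|; set t := #|[set i | u i == Some i]|.
case: (set_0Vmem [set i in S | u i == None]) => [u0|[x]].
  rewrite /r u0 cards0 a_n0t -card_full; apply: eq_card => l.
  rewrite inE [RHS]inE; case lS: (l \in _) => //=.
  have uN i : u i = None -> i \notin S.
    by move=> ui; apply/negP => iS; have := in_set0 i; rewrite -u0 inE iS ui.
  apply/balancedP/fullP => [[_ hl] i iS li|h].
    have [j uj ji] := hl i li; have jS := uN _ uj.
    by have := isolated uj (matching_out lS jS) ji => E; rewrite -E iS in jS.
  split=> i; first by move=> ui; exists i => //; apply: matching_out lS _; apply: uN.
  move=> li; exists i => //; apply: matching_out uS _; apply/negP => iS.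
  exact: h iS li.
rewrite inE => /andP[xS /eqP ux].
rewrite (card_matchings_split (balanced u) xS).
have eqS := cardsD1 x S; rewrite xS add1n in eqS.
have uSx : u \in matchings (S :\ x).
  apply/matchingsP => i j uij; rewrite !inE (matching_in uS uij).
  by rewrite (matching_sym uS uij); case: eqP => // ix; rewrite ix ux in uij.
rewrite IHm //; last by rewrite -ltnS -eqS.
have eqr : r = #|[set i in S :\ x | u i == None]|.+1.
  rewrite /r (cardsD1 x) !inE xS ux eqxx add1n; congr _.+1.
  by apply: eq_card => i; rewrite !inE andbA.
have at_ y : y \in S ->
    #|[set l in matchings S | (l x == Some y) && balanced u l]| =
    if ~~ ((u y == None) || (u y == Some y)) then a_nrt (#|S| - 2) r t else 0.
  move=> yS; rewrite if_neg; case: ifP => uy.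
    apply: eq_card0 => l; rewrite inE; apply/negP => /and3P[lS /eqP lx /balancedP[hu _]].
    have [b lb xb] := hu x ux; apply: (stuck lS ux lx _ xb) => // z uyz.
    by move: uy; rewrite uyz => /eqP[].
  case uyz: (u y) uy => [z|] //= /negP zy.
  have nzy : z <> y by move=> E; apply: zy; rewrite E.
  have zy' : z != y by apply/eqP.
  have nxy : x != y by apply/eqP => E; move: ux; rewrite E uyz.
  have nzx : z != x by apply/eqP => E; move: ux; rewrite -E (matching_sym uS uyz).
  rewrite (card_matchings_at (Q := balanced (cut u y)) xS yS); last first.
    by move=> l lS lx; apply: (contract_balanced uS lS ux lx uyz nzy).
  have u'S : cut u y \in matchings (S :\ x :\ y).
    exact: matchingsS (subsetDl _ _) (cut_matching uSx uyz).
  have leS : #|S :\ x :\ y| < m.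
    apply: leq_ltn_trans (subset_leq_card (subsetDl _ _)) _.
    by rewrite -ltnS -eqS.
  have cutE i : cut u y i = if (i == y) || (i == z) then None else u i.
    by rewrite ffunE uyz.
  have zS : z \in S := matching_inr uS uyz.
  have uz := matching_sym uS uyz.
  rewrite IHm // card_setD2 //; congr a_nrt.
    rewrite (cardsD1 z) !inE cutE eqxx orbT (negbTE zy') nzx zS /= eqr add1n.
    congr _.+1; apply: eq_card => i; rewrite !inE cutE.
    case: (eqVneq i z) => [->|_]; first by rewrite uz andbF.
    case: (eqVneq i y) => [->|_]; first by rewrite uyz /= ?andbF.
    by [].
  apply: eq_card => i; rewrite !inE cutE.
  case: (eqVneq i y) => [->|_] /=.
    by rewrite uyz; apply/esym/negbTE/eqP => -[E]; case: nzy.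
  case: (eqVneq i z) => [->|_] //=.
  by rewrite uz; apply/esym/negbTE/eqP => -[E]; case: nzy.
rewrite (eq_bigr _ at_) -big_mkcondr /= sum_nat_const.
have -> : #|[pred i | (i \in S) & ~~ ((u i == None) || (u i == Some i))]| =
    #|S| - r - t.
  have tS : [set i | u i == Some i] \subset S :\: [set i in S | u i == None].
    apply/subsetP => i; rewrite !inE => /eqP ui.
    by rewrite (matching_in uS ui) ui.
  have rS : [set i in S | u i == None] \subset S.
    by apply/subsetP => i; rewrite inE => /andP[].
  have <- : #|S :\: [set i in S | u i == None]| = #|S| - r.
    by rewrite cardsD (setIidPr rS).
  rewrite /t -(setIidPr tS) -cardsD; apply: eq_card => i; rewrite !inE.
  by case: (i \in S); case: (u i == None); case: (u i == Some i).
have <- : #|[set i | u i == Some i]| = t by [].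
have r_le : r <= #|S|.
  by rewrite /r; apply/subset_leq_card/subsetP=> i; rewrite inE => /andP[].
move: r_le; rewrite -/t eqr eqS subSS.
move: #|[set i in S :\ x | u i == None]| #|S :\ x| => q k; rewrite ltnS /=.
rewrite eqSS; case: eqP => [-> _|/eqP nqk le_qk].
  rewrite subnn mul0n addn0.
  by elim: k => //= k IHk; rewrite ?eqxx.
case: k nqk le_qk => [|k] nqk le_qk; first by rewrite leqn0 (negbTE nqk) in le_qk.
by rewrite !subSS subn0.
Qed.

(** * Counting matchings by free points and singletons *)

Definition frees u : {set T} := [set i | u i == None].
Definition loops u : {set T} := [set i | u i == Some i].

Lemma loops_sub u : loops u \subset ~: frees u.
Proof. by apply/subsetP=> i; rewrite !inE => /eqP->. Qed.

(** Forgetting the singletons leaves a fixed-point-free involution of the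
    points that are neither free nor singletons. *)
Lemma card_matchings_frees_loops (A L : {set T}) : L \subset ~: A ->
  #|[set u in matchings setT | (frees u == A) && (loops u == L)]| =
  if odd (#|T| - #|A| - #|L|) then 0 else dfact (#|T| - #|A| - #|L|).-1.
Proof.
move=> LA; set R := ~: A :\: L.
have <- : #|R| = #|T| - #|A| - #|L|.
  by rewrite cardsD (setIidPr LA) cardsCs setCK.
rewrite -card_fixfree.
pose fill (v : {ffun T -> option T}) : {ffun T -> option T} :=
  [ffun i => if i \in L then Some i else v i].
have vL (v : {ffun T -> option T}) i : v \in matchings R -> i \in L -> v i = None.
  by move=> vR iL; apply: matching_out vR _; rewrite !inE iL.
rewrite -[RHS](card_in_imset (f := fill)); last first.
  move=> v w; rewrite inE => /andP[vR _]; rewrite inE => /andP[wR _].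
  move=> /ffunP E; apply/ffunP=> i; have := E i; rewrite !ffunE.
  by case: ifP => // iL; rewrite (vL v) // (vL w).
apply: eq_card => u; apply/idP/imsetP => [|[v]]; rewrite inE; last first.
  rewrite inE => /andP[vR /andP[/fullP vf /forallP vx]] ->.
  have vfill : fill v \in matchings setT.
    apply/matchingsP => i j; rewrite !ffunE inE; case: ifP => [iL [<-]|iL vij].
      by rewrite iL.
    have := matching_inr vR vij; rewrite !inE => /andP[/negbTE-> _].
    by rewrite (matching_sym vR vij).
  rewrite vfill /=; apply/andP; split; apply/eqP/setP => i; rewrite inE ffunE.
    case: ifP => iL; first by have := subsetP LA i iL; rewrite inE => /negbTE->.
    case iA: (i \in A); first by rewrite (matching_out vR) // !inE iA andbF.
    by apply/eqP/vf; rewrite !inE iL iA.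
  by case: ifP => iL; [rewrite eqxx | apply/negbTE/vx].
move=> /andP[uT /andP[/eqP uA /eqP uL]].
pose v : {ffun T -> option T} := [ffun i => if i \in L then None else u i].
have iLP i : (i \in L) = (u i == Some i) by rewrite -uL inE.
have iAP i : (i \in A) = (u i == None) by rewrite -uA inE.
exists v; last first.
  by apply/ffunP => i; rewrite !ffunE; case iL: (i \in L) => //; apply/eqP; rewrite -iLP.
rewrite inE; apply/and3P; split.
- apply/matchingsP => i j; rewrite !ffunE; case: ifP => // iL uij.
  have uji := matching_sym uT uij; rewrite !inE iL iAP uij; split=> //.
  case: ifP => //; rewrite iLP uji => /eqP[ij].
  by move: iL; rewrite iLP uij -ij eqxx.
- apply/fullP => i; rewrite !inE ffunE => /andP[/negbTE-> iA].
  by apply/eqP; rewrite -iAP.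
by apply/forallP=> i; rewrite ffunE; case: ifP => // iL; rewrite -iLP iL.
Qed.

Lemma card_matchings_rank r t : r <= #|T| -> t <= #|T| - r ->
  #|[set u in matchings setT | (#|frees u| == r) && (#|loops u| == t)]| =
  if inI (#|T| - r) t then rho #|T| r t else 0.
Proof.
move=> rT tT; rewrite -sum1dep_card /inI tT /=.
rewrite (partition_big frees (fun A => #|A| == r)) => [|u /andP[_ /andP[]//]].
transitivity (\sum_(A : {set T} | #|A| == r)
  \sum_(L : {set T} | (L \subset ~: A) && (#|L| == t))
  if odd (#|T| - r - t) then 0 else dfact (#|T| - r - t).-1).
  apply: eq_bigr => A /eqP rA.
  rewrite (partition_big loops (fun L => (L \subset ~: A) && (#|L| == t))); last first.
    by move=> u /andP[/and3P[_ _ ->] /eqP <-]; rewrite loops_sub.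
  apply: eq_bigr => L /andP[LA /eqP tL].
  rewrite -rA -tL -(card_matchings_frees_loops LA) -sum1dep_card.
  apply: eq_bigl => u; rewrite -!andbA; case: (u \in _) => //=.
  case: (eqVneq (frees u) A) => [->|_]; last by rewrite !andbF.
  by case: (eqVneq (loops u) L) => [->|_]; rewrite ?andbF // !eqxx.
transitivity (\sum_(A : {set T} | #|A| == r)
    'C(#|T| - r, t) * if odd (#|T| - r - t) then 0 else dfact (#|T| - r - t).-1).
  apply: eq_bigr => A /eqP rA.
  have <- : #|[set L : {set T} | L \subset ~: A & #|L| == t]| = 'C(#|T| - r, t).
    by rewrite cards_draws cardsCs setCK rA.
  by rewrite sum_nat_const cardsE.
rewrite sum_nat_const /rho -(card_draws T r) cardsE -mulnA.
by case: odd; rewrite ?muln0.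
Qed.

End Matchings.

(** * The partial Brauer monoid as involutions *)

Section PartialBrauer.

Variable n : nat.
Implicit Types (a b : PB n) (x y : vertex n) (i j : 'I_n).

Lemma PB_partition a : partition (blocks a) setT.
Proof. by case/andP: (blocksP a). Qed.

Lemma PB_pblock a x : pblock (blocks a) x \in blocks a.
Proof. by rewrite pblock_mem // (cover_partition (PB_partition a)) inE. Qed.

(** The other point of the block of [x], or [x] if the block is a singleton;
    partitions into blocks of size at most two correspond to involutions. *)
Definition mate a x := odflt x [pick y in pblock (blocks a) x | y != x].

Lemma pblock_mate a x : pblock (blocks a) x = [set x; mate a x].
Proof.
have xx : x \in pblock (blocks a) x.
  by rewrite mem_pblock (cover_partition (PB_partition a)) inE.
have le2 : #|pblock (blocks a) x| <= 2.
  by case/andP: (blocksP a) => _ /forall_inP; apply; apply: PB_pblock.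
rewrite /mate; case: pickP => [y /andP[yx nyx]|none] /=.
  apply/esym/eqP; rewrite eqEcard cards2 eq_sym nyx le2 andbT.
  by apply/subsetP => z; rewrite !inE => /orP[]/eqP->.
rewrite setUid; apply/setP => y; rewrite inE; apply/idP/eqP => [yx|->//].
by apply/eqP; have := none y; rewrite yx /= => /negbFE.
Qed.

Lemma block_mate a x y : ([set x; y] \in blocks a) = (mate a x == y).
Proof.
have /and3P[_ tI _] := PB_partition a.
apply/idP/eqP => [B|<-]; last by rewrite -pblock_mate PB_pblock.
have /setP E := etrans (esym (pblock_mate a x)) (def_pblock tI B (set21 x y)).
have := E y; have := E (mate a x); rewrite !inE !eqxx !orbT.
move=> /esym/orP[/eqP mx|/eqP//]; rewrite mx orbb => /eqP yx.
by rewrite yx.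
Qed.

Lemma block1_mate a x : ([set x] \in blocks a) = (mate a x == x).
Proof. by rewrite -block_mate setUid. Qed.

Lemma mateK a : involutive (mate a).
Proof. by move=> x; apply/eqP; rewrite -block_mate setUC block_mate. Qed.

Lemma mate_sym a x y : mate a x = y -> mate a y = x.
Proof. by move=> <-; rewrite mateK. Qed.

Lemma blocks_mate a :
  blocks a = equivalence_partition (fun x y => (y == x) || (y == mate a x)) setT.
Proof.
rewrite -(equivalence_partition_pblock (PB_partition a)).
apply: eq_imset => x; apply/setP => y; rewrite !inE /=.
by rewrite pblock_mate !inE.
Qed.

Lemma mate_inj a b : mate a =1 mate b -> a = b.
Proof.
move=> E; apply: val_inj; rewrite /= (blocks_mate a) (blocks_mate b).
by apply: eq_imset => x; apply/setP => y; rewrite !inE /= E.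
Qed.

(** Every involution arises, which serves to build elements with prescribed
    patterns. *)
Lemma mate_exists (f : vertex n -> vertex n) : involutive f ->
  exists a, mate a =1 f.
Proof.
move=> fK; pose R x y := (y == x) || (y == f x).
have eqR : {in [set: vertex n] & &, equivalence_rel R}.
  move=> x y z _ _ _; rewrite /R eqxx; split=> // /orP[]/eqP-> //.
  by rewrite fK orbC.
have PBR : is_PB (equivalence_partition R setT).
  rewrite /is_PB equivalence_partitionP //=.
  apply/forall_inP => _ /imsetP[x _ ->].
  rewrite (_ : [set y in _ | _] = [set x; f x]); last by apply/setP=> y; rewrite !inE.
  by rewrite cards2; case: eqP.
exists (MkPB PBR) => x; apply/eqP; rewrite -block_mate /=.
by apply/imsetP; exists x => //; apply/setP=> y; rewrite !inE.
Qed.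

Lemma edge_viaP (f : vertex n -> gvertex n) a u v : injective f ->
  reflect (exists x, [/\ mate a x != x, u = f x & v = f (mate a x)])
          (edge_via f a u v).
Proof.
move=> fI; apply: (iffP existsP) => [[B /and3P[Ba /eqP cB /eqP fB]]|[x [mx -> ->]]].
  have : u \in f @: B by rewrite fB set21.
  case/imsetP => x xB ux; exists x.
  have eB : B = [set x; mate a x].
    by have /and3P[_ tI _] := PB_partition a; rewrite -(def_pblock tI Ba xB) pblock_mate.
  have mx : mate a x != x.
    by apply/eqP => mx; move: cB; rewrite eB mx setUid cards1.
  split=> //; have : f (mate a x) \in f @: B by rewrite imset_f // eB set22.
  by rewrite fB !inE => /orP[/eqP|/eqP//]; rewrite ux => /fI E; rewrite E eqxx in mx.
exists [set x; mate a x]; rewrite block_mate eqxx cards2 (eq_sym x) mx /=.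
by rewrite imsetU !imset_set1.
Qed.

(** * Upper and lower patterns *)

Definition up a : {ffun 'I_n -> option 'I_n} :=
  [ffun i => if mate a (inl i) is inl j then Some j else None].
Definition low a : {ffun 'I_n -> option 'I_n} :=
  [ffun i => if mate a (inr i) is inr j then Some j else None].

Lemma up_some a i j : (up a i == Some j) = (mate a (inl i) == inl j).
Proof. by rewrite ffunE; case: (mate a _). Qed.

Lemma low_some a i j : (low a i == Some j) = (mate a (inr i) == inr j).
Proof. by rewrite ffunE; case: (mate a _). Qed.

Lemma up_none a i : up a i = None <-> exists j, mate a (inl i) = inr j.
Proof.
rewrite ffunE; case: (mate a _) => j; last by split=> // _; exists j.
by split=> // -[].
Qed.

Lemma low_none a i : low a i = None <-> exists j, mate a (inr i) = inl j.
Proof.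
rewrite ffunE; case: (mate a _) => j; first by split=> // _; exists j.
by split=> // -[].
Qed.

Lemma up_matching a : up a \in matchings setT.
Proof.
apply/matchingsP => i j /eqP; rewrite up_some => /eqP/mate_sym/eqP.
by rewrite -up_some inE => /eqP.
Qed.

Lemma low_matching a : low a \in matchings setT.
Proof.
apply/matchingsP => i j /eqP; rewrite low_some => /eqP/mate_sym/eqP.
by rewrite -low_some inE => /eqP.
Qed.

Lemma Lambda_up_eq a b : (Lambda_up b == Lambda_up a) = (up b == up a).
Proof.
have LE c p : (p \in Lambda_up c) = (up c p.1 == Some p.2).
  rewrite inE up_some -block_mate; case: eqP => // ->; by rewrite setUid.
apply/eqP/eqP => [/setP E|E]; last by apply/setP => p; rewrite !LE E.
apply/ffunP => i; case bi : (up b i) => [j|].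
  by have := E (i, j); rewrite !LE bi eqxx => /esym/eqP.
case ai: (up a i) => [j|] //.
by have := E (i, j); rewrite !LE ai eqxx bi.
Qed.

Lemma rank_frees a : rank a = #|frees (up a)|.
Proof.
have pbi : {in frees (up a) &, injective (fun i => pblock (blocks a) (inl i))}.
  move=> i j; rewrite inE => /eqP/up_none[i' mi] _ /setP/(_ (inl j)).
  by rewrite !pblock_mate !inE eqxx mi /= orbF => /eqP[].
rewrite -(card_in_imset pbi) /rank; apply: eq_card => B; rewrite inE.
apply/idP/imsetP => [/and3P[Ba /existsP[i iB] /existsP[j jB]]|[i]].
  have /and3P[_ tI _] := PB_partition a; have eB := def_pblock tI Ba iB.
  exists i => //; rewrite inE; apply/eqP/up_none; exists j.
  by move: jB; rewrite -eB pblock_mate !inE /= => /eqP.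
rewrite inE => /eqP/up_none[j mi] ->; rewrite PB_pblock pblock_mate mi.
by apply/and3P; split=> //; apply/existsP; [exists i|exists j]; rewrite !inE eqxx ?orbT.
Qed.

Lemma upper_singletons_loops a : upper_singletons a = #|loops (up a)|.
Proof. by apply: eq_card => i; rewrite !inE block1_mate up_some. Qed.

(** * Idempotents *)

Definition middle a := overlay (up a) (low a).

Lemma middle_sym a : connect_sym (middle a).
Proof.
exact/sym_connect_sym/(overlay_sym (up_matching a) (low_matching a)).
Qed.

Lemma Gamma_top a x : connect (Gamma a a) (top_emb x) (top_emb (mate a x)).
Proof.
case: (eqVneq (mate a x) x) => [->|mx]; first exact: connect0.
by apply/connect1/orP; left; apply/(edge_viaP _ _ _ (@top_emb_inj n)); exists x.
Qed.

Lemma Gamma_bot a x : connect (Gamma a a) (bot_emb x) (bot_emb (mate a x)).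
Proof.
case: (eqVneq (mate a x) x) => [->|mx]; first exact: connect0.
by apply/connect1/orP; right; apply/(edge_viaP _ _ _ (@bot_emb_inj n)); exists x.
Qed.

Lemma Gamma_middle a i j : connect (middle a) i j ->
  connect (Gamma a a) (inr i) (inr j).
Proof.
move=> ij0.
apply: (connect_inv (P := fun j => connect (Gamma a a) (inr i) (inr j))) ij0 _;
  last exact: connect0.
move=> {}j k ij jk; apply: connect_trans ij _.
move: jk => /orP[]; rewrite ?up_some ?low_some => /eqP E.
  by have := Gamma_bot a (inl j); rewrite E.
by have := Gamma_top a (inr j); rewrite E.
Qed.

(** If the square is the element itself, then [i] and [j'] are joined in the
    product graph; the only way into the middle row from [i] is through [j], and
    the only way out to [j'] is through [i], so [i] and [j] are joined inside the
    middle row.  Conversely the condition makes the two points of each block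
    joined in the product graph, and a point has at most one other outer point in
    its component. *)
Lemma idempotentP a :
  reflect (forall i j, mate a (inl i) = inr j -> connect (middle a) i j)
          (Defs.mul a a == a).
Proof.
apply: (iffP eqP) => [aa i j mi|h].
  have : joined a a (inl i) (inr j).
    have eqv := @joined_equiv n a a.
    rewrite -(pblock_equivalence_partition eqv) ?inE //.
    have -> : equivalence_partition (joined a a) setT = blocks a.
      by rewrite -[in RHS]aa.
    by rewrite pblock_mate mi set22.
  (* The component of [j] in the middle row and the outer points attached to
     it by a transversal: a set closed under the edges of the product graph. *)
  pose P (g : gvertex n) := match g with
    | inr k => connect (middle a) j k
    | inl (inl p) => if mate a (inl p) is inr k then connect (middle a) j k else false
    | inl (inr p) => if mate a (inr p) is inl k then connect (middle a) j k else false
    end.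
  move=> /(connect_inv (P := P)) PP.
  rewrite middle_sym; have := PP _; rewrite /= mi (mate_sym mi); apply=> //.
  have step k p q : connect (middle a) k p -> middle a p q -> connect (middle a) k q.
    by move=> kp pq; apply: connect_trans kp (connect1 pq).
  move=> g g' Pg /orP[] /edge_viaP.
    move=> /(_ (@top_emb_inj n))[[p|p] [_ eg eg']]; move: Pg; rewrite {}eg {}eg' /=.
      by case: (mate a (inl p)).
    case E: (mate a (inr p)) => [q|q] /=; first by rewrite (mate_sym E).
    by move=> jp; apply: step jp _; rewrite /middle /overlay low_some E eqxx orbT.
  move=> /(_ (@bot_emb_inj n))[[p|p] [_ eg eg']]; move: Pg; rewrite {}eg {}eg' /=.
    case E: (mate a (inl p)) => [q|q] /=; last by rewrite (mate_sym E).
    by move=> jp; apply: step jp _; rewrite /middle /overlay up_some E eqxx.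
  by case: (mate a (inr p)).
have jC x y : joined a a x y = joined a a y x.
  exact: (sym_connect_sym (@Gamma_sym n a a)).
have j_lr i j : mate a (inl i) = inr j -> joined a a (inl i) (inr j).
  move=> mi; apply: connect_trans (_ : connect _ (inr j) _).
    by have := Gamma_top a (inl i); rewrite mi.
  apply: connect_trans (_ : connect _ (inr i) _).
    by apply: Gamma_middle; rewrite middle_sym h.
  by have := Gamma_bot a (inl i); rewrite mi.
have jm x : joined a a x (mate a x).
  case: x => i; case E: (mate a _) => [j|j].
  - by have := Gamma_top a (inl i); rewrite E.
  - exact: j_lr.
  - by rewrite jC j_lr // (mate_sym E).
  - by have := Gamma_bot a (inr i); rewrite E.
apply: val_inj; rewrite /= (blocks_mate a); apply: eq_imset => x.
apply/setP => y; rewrite !inE /=; apply/idP/idP => [xy|/orP[]/eqP->//];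
  last exact: connect0.
case: (eqVneq y x) => //= yx; case: (eqVneq (mate a x) x) => mx; last first.
  by apply/eqP; apply: joined_uniq xy (jm x) _ _; rewrite eq_sym.
suff /eqP[E] : inl y == inl x :> gvertex n by rewrite E eqxx in yx.
apply: (connect_inv (P := pred1 (inl x))) xy _ => [g g' /eqP-> + |];
  last by rewrite /= eqxx.
case/orP=> /edge_viaP.
  move=> /(_ (@top_emb_inj n))[[p|p] [mp eg _]]; rewrite /top_emb in eg; last by [].
  by case: eg mp => <-; rewrite mx eqxx.
move=> /(_ (@bot_emb_inj n))[[p|p] [mp eg _]]; rewrite /bot_emb in eg; first by [].
by case: eg mp => <-; rewrite mx eqxx.
Qed.

Lemma idempotent_balanced a : Defs.mul a a == a -> balanced (up a) (low a).
Proof.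
move=> /idempotentP h; apply/balancedP; split=> i.
  move=> /up_none[j mi]; exists j; last exact: h.
  by apply/low_none; exists i; apply: mate_sym.
move=> /low_none[j mi]; exists j; last by apply: h; apply: mate_sym.
by apply/up_none; exists i; apply: mate_sym.
Qed.

(** The partner of a free upper point is the lower free point in its component,
    which is unique, so the two patterns determine an idempotent. *)
Lemma idempotent_inj a b : Defs.mul a a == a -> Defs.mul b b == b ->
  up a = up b -> low a = low b -> a = b.
Proof.
move=> /idempotentP ha /idempotentP hb eu el.
have lr i j : mate a (inl i) = inr j -> mate b (inl i) = inr j.
  move=> mi; have ui : up b i = None by rewrite -eu; apply/up_none; exists j.
  have /up_none[j' mi'] := ui; rewrite mi'; congr inr.
  apply: (free_end_uniq (up_matching b) (low_matching b) ui _ _ (hb _ _ mi')).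
  - by apply/low_none; exists i; apply: mate_sym.
  - by rewrite -el; apply/low_none; exists i; apply: mate_sym.
  by have := ha _ _ mi; rewrite /middle eu el.
apply: mate_inj => -[] i; case E: (mate a _) => [j|j]; apply/esym.
- by apply/eqP; rewrite -up_some -eu up_some E.
- exact: lr.
- by apply/mate_sym/lr/mate_sym.
- by apply/eqP; rewrite -low_some -el low_some E.
Qed.

(** The transversals are dictated by the components; uniqueness of the free
    point of [l], and, with the roles exchanged, of [u], makes the resulting
    assignment an involution. *)
Lemma idempotent_exists (u l : {ffun 'I_n -> option 'I_n}) :
    u \in matchings setT -> l \in matchings setT -> balanced u l ->
  exists a, [/\ up a = u, low a = l & Defs.mul a a == a].
Proof.
move=> uT lT /balancedP[hu hl].
have csym := sym_connect_sym (overlay_sym uT lT).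
pose dn i := odflt i [pick j | (l j == None) && connect (overlay u l) i j].
pose upw j := odflt j [pick i | (u i == None) && connect (overlay u l) i j].
have dnP i : u i = None -> l (dn i) = None /\ connect (overlay u l) i (dn i).
  move=> ui; rewrite /dn; case: pickP => [j /andP[/eqP lj ij]|no] //=.
  by have [j lj ij] := hu i ui; have := no j; rewrite lj ij eqxx.
have upP j : l j = None -> u (upw j) = None /\ connect (overlay u l) (upw j) j.
  move=> lj; rewrite /upw; case: pickP => [i /andP[/eqP ui ij]|no] //=.
  by have [i ui ij] := hl j lj; have := no i; rewrite ui ij eqxx.
pose f (x : vertex n) : vertex n := match x with
  | inl i => if u i is Some k then inl k else inr (dn i)
  | inr j => if l j is Some k then inr k else inl (upw j)
  end.
have fK : involutive f.
  move=> [i|i] /=.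
    case E: (u i) => [k|] /=; first by rewrite (matching_sym uT E).
    have [ld id] := dnP i E; rewrite ld; have [uw wd] := upP _ ld; congr inl.
    apply: (free_end_uniq lT uT ld uw E); rewrite (eq_connect (overlayC l u)).
      by rewrite csym.
    by rewrite csym.
  case E: (l i) => [k|] /=; first by rewrite (matching_sym lT E).
  have [uw wi] := upP i E; rewrite uw; have [ld wd] := dnP _ uw; congr inr.
  exact: (free_end_uniq uT lT uw ld E).
have [a ma] := mate_exists fK.
have ua : up a = u by apply/ffunP => i; rewrite ffunE ma /=; case: (u i).
have la : low a = l by apply/ffunP => i; rewrite ffunE ma /=; case: (l i).
exists a; split=> //; apply/idempotentP => i j; rewrite ma /middle ua la /=.
by case E: (u i) => [k|] // [<-]; case: (dnP i E).
Qed.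

Lemma card_idempotent_up (u : {ffun 'I_n -> option 'I_n}) :
    u \in matchings setT ->
  #|[set a | (up a == u) && (Defs.mul a a == a)]| = a_nrt n #|frees u| #|loops u|.
Proof.
move=> uT; transitivity #|[set l in matchings setT | balanced u l]|; last first.
  rewrite (card_balanced uT) cardsT card_ord; congr a_nrt.
  by apply: eq_card => i; rewrite !inE.
rewrite -(card_in_imset (f := low)); last first.
  move=> a b; rewrite inE => /andP[/eqP ua ia]; rewrite inE => /andP[/eqP ub ib].
  by apply: idempotent_inj; rewrite // ua.
apply: eq_card => l; apply/imsetP/idP => [[a]|].
  rewrite inE => /andP[/eqP <- ia] ->.
  by rewrite inE low_matching idempotent_balanced.
rewrite inE => /andP[lT ul]; have [a [ua <- ia]] := idempotent_exists uT lT ul.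
by exists a => //; rewrite inE ua eqxx.
Qed.

(** * Summation over upper patterns *)

Lemma e_R_class a : e (R_class a) = a_nrt n (rank a) (upper_singletons a).
Proof.
rewrite rank_frees upper_singletons_loops -card_idempotent_up ?up_matching //.
by apply: eq_card => b; rewrite !inE Lambda_up_eq.
Qed.

Lemma e_D_class r : r <= n ->
  e (D_class n r) =
  \sum_(0 <= s < (n - r).+1 | inI (n - r) s) rho n r s * a_nrt n r s.
Proof.
move=> le_rn; pose M := matchings [set: 'I_n].
transitivity (\sum_(u in M | #|frees u| == r) a_nrt n r #|loops u|).
  rewrite /e -sum1_card.
  rewrite (partition_big up (fun u => (u \in M) && (#|frees u| == r))); last first.
    move=> a; rewrite inE => /andP[+ _].
    by rewrite inE rank_frees => ->; rewrite up_matching.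
  apply: eq_bigr => u /andP[uM /eqP ur].
  rewrite -[in RHS]ur -card_idempotent_up // -sum1dep_card; apply: eq_bigl => a.
  rewrite !inE rank_frees andbC; case: eqP => //= ->.
  by rewrite ur eqxx.
(* [inord] does not truncate here: at most [n - r] singletons fit beside the
   [r] free points. *)
rewrite big_mkord.
rewrite (partition_big (fun u => inord #|loops u| : 'I_(n - r).+1) predT) //=.
rewrite [RHS]big_mkcond; apply: eq_bigr => s _.
have s_le : s <= n - r by rewrite -ltnS.
have := @card_matchings_rank 'I_n r s; rewrite card_ord => /(_ le_rn s_le) cE.
transitivity (\sum_(u in [set u in M | (#|frees u| == r) && (#|loops u| == s)])
   a_nrt n r s); last first.
  by rewrite sum_nat_const cE; case: ifP.
have loopsE (u : {ffun 'I_n -> option 'I_n}) :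
    #|frees u| == r -> #|loops u| < (n - r).+1.
  move=> /eqP ur; rewrite ltnS -ur.
  have := subset_leq_card (loops_sub u).
  by have := cardsC (frees u); rewrite card_ord; lia.
have sE (u : {ffun 'I_n -> option 'I_n}) :
    #|frees u| == r -> (inord #|loops u| == s) = (#|loops u| == s).
  by move=> ur; rewrite -(inj_eq val_inj) /= inordK // loopsE.
apply: eq_big => u; last first.
  by move=> /andP[/andP[_ ur]]; rewrite sE // => /eqP->.
by rewrite [RHS]inE -andbA; case: (u \in M) => //=;
  case ur: (_ == r) => //=; apply: sE.
Qed.

End PartialBrauer.

Lemma e_setT n : e [set: PB n] = \sum_(0 <= q < n.+1) e (D_class n q).
Proof.
rewrite big_mkord /e -sum1_card.
have rank_le (a : PB n) : rank a < n.+1.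
  by rewrite ltnS rank_frees -[X in _ <= X]card_ord max_card.
rewrite (partition_big (fun a : PB n => inord (rank a) : 'I_n.+1) predT) //=.
apply: eq_bigr => q _; rewrite -sum1_card; apply: eq_bigl => a.
rewrite !inE andbC; congr (_ && _).
by rewrite -(inj_eq val_inj) /= inordK.
Qed.

Lemma sum_inJ n q (F : nat -> nat) : q <= n ->
  \sum_(0 <= s < n.+1 | inJ n q s) F s =
  \sum_(0 <= s < (n - q).+1 | inI (n - q) s) F s.
Proof.
move=> le_qn; rewrite (big_cat_nat (n := (n - q).+1)) //=; last by rewrite ltnS leq_subr.
rewrite [X in _ + X]big1_seq ?addn0 => [|s]; last first.
  rewrite mem_index_iota /inJ /inI => /andP[/and3P[_ _ /andP[le_s _]] /andP[lt_s _]].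
  by rewrite leqNgt lt_s in le_s.
apply: congr_big_nat => // s /andP[_]; rewrite ltnS => le_s.
by rewrite /inJ le_qn (leq_trans le_s (leq_subr _ _)).
Qed.

Lemma dfact_double k : dfact (2 * k).-1 * (2 ^ k * k`!) = (2 * k)`!.
Proof.
elim: k => // k IHk.
have -> : (2 * k.+1)`! = (2 * k).+2 * ((2 * k).+1 * (2 * k)`!).
  by rewrite mulnS add2n !factS.
have -> : dfact (2 * k.+1).-1 = (2 * k).+1 * dfact (2 * k).-1.
  by rewrite mulnS add2n; case: k {IHk} => // k; rewrite mulnS add2n.
rewrite -IHk expnS factS -(addn2 (2 * k)) -(addn1 (2 * k)) -(addn1 k); ring.
Qed.

Theorem theorem32 (n r t : nat) (hJ : inJ n r t) :
  [/\ (forall k : nat, n - r - t = 2 * k ->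
        ((rho n r t)%:R =
           n`!%:R / (2 ^+ k * k`!%:R * r`!%:R * t`!%:R) :> rat)%R),
      (forall a : PB n, a \in D_class n r -> upper_singletons a = t ->
        e (R_class a) = a_nrt n r t),
      e (D_class n r) =
        \sum_(0 <= s < (n - r).+1 | inI (n - r) s) rho n r s * a_nrt n r s &
      e [set: PB n] =
        \sum_(0 <= q < n.+1) \sum_(0 <= s < n.+1 | inJ n q s)
          rho n q s * a_nrt n q s].
Proof.
have /and3P[le_rn _ /andP[le_t _]] := hJ; split.
- move=> k nk; apply: (canRL (GRing.mulfK _)).
    by rewrite !GRing.mulf_neq0 ?GRing.expf_neq0 // Num.Theory.pnatr_eq0 -lt0n fact_gt0.
  rewrite -GRing.natrX -!GRing.natrM; congr (_%:R)%R.
  rewrite /rho nk -(bin_fact le_rn) -(bin_fact le_t) nk -dfact_double.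
  by ring.
- by move=> a; rewrite inE => /eqP <- <-; apply: e_R_class.
- exact: e_D_class.
rewrite e_setT !big_mkord; apply: eq_bigr => q _.
by rewrite sum_inJ ?e_D_class // -ltnS.
Qed.
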